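(* Let $G$ be a finite unit-distance graph with $V(G)\subset L_{Moser}$. Then $G$ has a non-fractional geometric coloring with at most $4$ colors; in particular, $\chi_{gf}(G)\le 4$.
   Context: Let $\omega_1 = \frac12 + i\frac{\sqrt3}{2}$ and $\omega_3 = \frac56 + i\frac{\sqrt{11}}{6}$ in $\mathbb{C}\cong\mathbb{R}^2$, and let the Moser lattice be $L_{Moser} = \{a + b\omega_1 + c\omega_3 + d\omega_1\omega_3 : a,b,c,d\in\mathbb{Z}\}$. A finite unit-distance graph $G$ is a graph whose vertex set is a finite set of points of the plane and whose edges join points at Euclidean distance $1$. Let $I(G)$ be the set of independent sets of $G$. A fractional coloring of $G$ is a function $\gamma: I(G)\to\mathbb{R}$ such that (1) $\gamma(S)\ge 0$ for all $S\in I(G)$, and (2) $\sum_{S\in I(G),\, x\in S}\gamma(S)\ge 1$ for every vertex $x\in V(G)$. It is geometric if moreover (3) $\sum_{Z\in I(G),\, S\subseteq Z}\gamma(Z) = \sum_{Z'\in I(G),\, S'\subseteq Z'}\gamma(Z')$ for any two $S,S'\subseteq V(G)$ which are isometric as subsets of the plane. The geometric fractional chromatic number $\chi_{gf}(G)$ is the least possible value of $\sum_{S\in I(G)}\gamma(S)$ over all geometric fractional colorings $\gamma$ of $G$. A coloring is non-fractional (integral) if $\gamma(S)\in\{0,1\}$ for all $S\in I(G)$; here each vertex lies in exactly one independent set $S$ with $\gamma(S)=1$, and the colors are the sets $S$ with $\gamma(S)=1$. *)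

(* Defs.v *)
From HB Require Import structures.
From mathcomp Require Import all_boot all_order all_algebra finmap.
From mathcomp Require Import all_classical all_reals.
From mathcomp Require Import topology normedtype derive.
From mathcomp Require Import complex.

Set Implicit Arguments.
Unset Strict Implicit.
Unset Printing Implicit Defensive.

Import Order.TTheory GRing.Theory Num.Theory numFieldNormedType.Exports.
Local Open Scope ring_scope.
Local Open Scope complex_scope.

Definition omega1 (R : realType) : R[i] := (1 / 2) +i* (Num.sqrt 3 / 2).

Definition omega3 (R : realType) : R[i] := (5 / 6) +i* (Num.sqrt 11 / 6).

Definition moser_lattice (R : realType) : set R[i] :=
  [set z | exists a b c d : int,
     z = a%:~R + b%:~R * omega1 R + c%:~R * omega3 R
         + d%:~R * (omega1 R * omega3 R)].

(* The plane is R[i], where `|x - y| is the Euclidean distance (as an element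
   of R[i] with zero imaginary part).  Edges join points at distance 1, but not
   every such pair has to be an edge. *)
Record udgraph (R : realType) := UDGraph {
  vertices : {fset R[i]};
  edge : rel vertices;
  edge_sym : symmetric edge;
  edge_dist1 : forall x y, edge x y -> `|val x - val y| = 1
}.

Definition independent (R : realType) (G : udgraph R)
    (S : {set vertices G}) : bool :=
  [forall x in S, forall y in S, ~~ edge x y].

Definition indep_set (R : realType) (G : udgraph R) :=
  {S : {set vertices G} | independent S}.

Definition isometric (R : realType) (G : udgraph R)
    (S S' : {set vertices G}) : Prop :=
  exists2 f : vertices G -> vertices G, f @: S = S' &
    {in S &, forall x y, `|val (f x) - val (f y)| = `|val x - val y|}.

Definition fractional_coloring (R : realType) (G : udgraph R)
    (g : indep_set G -> R) : Prop :=
  (forall S, 0 <= g S) /\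
  (forall x : vertices G, 1 <= \sum_(S : indep_set G | x \in val S) g S).

Definition geometric (R : realType) (G : udgraph R)
    (g : indep_set G -> R) : Prop :=
  forall S S' : {set vertices G}, isometric S S' ->
    \sum_(Z : indep_set G | S \subset val Z) g Z =
    \sum_(Z : indep_set G | S' \subset val Z) g Z.

Definition geometric_fractional_coloring (R : realType) (G : udgraph R)
    (g : indep_set G -> R) : Prop :=
  fractional_coloring g /\ geometric g.

Definition colors (R : realType) (G : udgraph R) (g : indep_set G -> R) :
    {set indep_set G} :=
  [set S | g S == 1].

Definition integral_coloring (R : realType) (G : udgraph R)
    (g : indep_set G -> R) : Prop :=
  (forall S, g S = 0 \/ g S = 1) /\
  (forall x : vertices G, exists! S, S \in colors g /\ x \in val S).

(* This infimum is a minimum, see chi_gf_min below. *)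
Definition chi_gf (R : realType) (G : udgraph R) : R :=
  inf [set \sum_(S : indep_set G) g S
      | g in @geometric_fractional_coloring R G]%classic.

Section ChiGfMin.
Context (R : realType) (G : udgraph R).
Implicit Types (S : {set vertices G}) (g : indep_set G -> R).

Let total g : R := \sum_(S : indep_set G) g S.

Let single (Z : indep_set G) : R := (#|val Z| == 1%N)%:R.

Lemma independent_set1 (x : vertices G) : independent [set x].
Proof.
apply/'forall_implyP => y /set1P ->; apply/'forall_implyP => z /set1P ->.
apply/negP => /edge_dist1 /eqP.
by rewrite subrr normr0 eq_sym oner_eq0.
Qed.

Lemma isometric_card S S' : isometric S S' -> #|S'| = #|S|.
Proof.
move=> [f <- fd]; rewrite card_in_imset// => x y xS yS fxy.
move: (fd x y xS yS); rewrite fxy subrr normr0 => /esym/eqP.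
by rewrite normr_eq0 subr_eq0 => /eqP/val_inj.
Qed.

Lemma sum_single S : S != finset.set0 ->
  \sum_(Z : indep_set G | S \subset val Z) single Z = (#|S| == 1%N)%:R.
Proof.
move=> S0; have [/cards1P[x Sx]|S1] := boolP (#|S| == 1%N).
  pose X : indep_set G := exist _ [set x] (independent_set1 x).
  rewrite (bigD1 X) /= ?Sx// /single /= cards1 eqxx big1 ?addr0//.
  move=> Z /andP[xZ ZX]; case: cards1P => // -[y Zy]; case/eqP: ZX.
  by apply/val_inj; move: xZ; rewrite Zy finset.sub1set /= => /set1P ->.
rewrite big1// => Z SZ; rewrite /single; case: eqP => // Z1.
have := subset_leq_card SZ; rewrite Z1 leq_eqVlt (negbTE S1)/= ltnS leqn0.
by rewrite cards_eq0 (negbTE S0).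
Qed.

Lemma single_geometric : geometric_fractional_coloring single.
Proof.
split; first split=> [Z|x]; first by rewrite /single ler0n.
  under eq_bigl do rewrite -finset.sub1set.
  by rewrite sum_single ?cards1// -card_gt0 cards1.
move=> S S' SS'; have cSS' := isometric_card SS'.
have [S0|S0] := eqVneq S finset.set0.
  by move: cSS'; rewrite S0 cards0 => /eqP; rewrite cards_eq0 => /eqP ->.
by rewrite !sum_single// ?cSS'// -cards_eq0 cSS' cards_eq0.
Qed.

Let T := prod_topology (fun _ : indep_set G => R : topologicalType).

Let sum_cont (P : pred (indep_set G)) :
  continuous ((fun g => \sum_(Z | P Z) g Z) : T -> R).
Proof.
apply: continuous_big => [|i _].
  exact: add_continuous.
exact: (@proj_continuous _ (fun _ => R : topologicalType) i).
Qed.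

Lemma closed_geometric :
  closed ([set g | geometric_fractional_coloring g]%classic : set T).
Proof.
have -> : [set g | geometric_fractional_coloring g]%classic =
  (\bigcap_(Z in setT) [set g : T | 0 <= g Z] `&`
   \bigcap_(x in setT)
     [set g : T | (1 <= \sum_(Z : indep_set G | x \in val Z) g Z)%R] `&`
   \bigcap_(p in [set p | isometric p.1 p.2])
     [set g : T | (\sum_(Z : indep_set G | p.1 \subset val Z) g Z -
        \sum_(Z : indep_set G | p.2 \subset val Z) g Z)%R = 0])%classic.
  apply/seteqP; split=> g /=.
    move=> [[g0 g1] gg]; split; first split; [by move=> Z _; exact: g0|..].
      by move=> x _; exact: g1.
    by move=> [S S'] /= SS'; rewrite (gg _ _ SS') subrr.
  move=> [[g0 g1] gg]; split; first by split=> [Z|x]; [exact: g0|exact: g1].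
  by move=> S S' SS'; apply/eqP; rewrite -subr_eq0 (gg (S, S')).
apply: closedI; first apply: closedI; apply: closed_bigI => i _.
- apply: (@preimage_closed T R (fun g => g i) _ _ (@closed_ge R 0)).
  by move=> x _; exact: (@proj_continuous _ (fun _ => R : topologicalType) i).
- apply: (@preimage_closed T R _ _ _ (@closed_ge R 1)).
  by move=> x _; exact: sum_cont.
- apply: (@preimage_closed T R _ _ _ (@closed_eq R 0)).
  move=> x _; apply: (@continuousB _ R^o); exact: sum_cont.
Qed.

Lemma chi_gf_min :
  exists2 g, geometric_fractional_coloring g & total g = chi_gf G.
Proof.
pose K : set T := ([set g | forall Z, (`[0, total single])%classic (g Z)] `&`
  [set g | geometric_fractional_coloring g])%classic.
have le_total g : geometric_fractional_coloring g -> forall Z, g Z <= total g.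
  move=> [[g0 _] _] Z; rewrite /total (bigD1 Z)//= lerDl.
  by apply: sumr_ge0 => ? _; exact: g0.
have inK g : geometric_fractional_coloring g -> total g <= total single -> K g.
  move=> gg gs; split=> //= Z; rewrite in_itv/= gg.1.1/=.
  by rewrite (le_trans (le_total _ gg Z)).
have cK : compact K.
  apply: compact_closedI closed_geometric.
  apply: (@tychonoff _ (fun=> R : topologicalType)
    (fun=> `[0, total single]%classic)) => _; exact: segment_compact.
have K0 : K !=set0%classic.
  by exists single; apply: inK => //; exact: single_geometric.
have [|c cK' cmin] := @compact_EVT_min T R total K K0 cK.
  exact/continuous_subspaceT/sum_cont.
have [_ cg] := set_mem cK'; exists c => //.
have cle g : geometric_fractional_coloring g -> total c <= total g.
  move=> gg; have [gs|/ltW] := leP (total g) (total single).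
    by apply: cmin; rewrite inE; exact: inK.
  apply: le_trans; apply: cmin; rewrite inE.
  by apply: inK => //; exact: single_geometric.
apply/eqP; rewrite eq_le; apply/andP; split.
  apply: lb_le_inf; first by exists (total c), c.
  by move=> _ [g gg <-]; exact: cle.
apply: ge_inf; last by exists c.
by exists (total c) => _ [g gg <-]; exact: cle.
Qed.

End ChiGfMin.

(* Main.v *)
Require Import Defs.
From mathcomp Require Import all_boot all_order all_algebra finmap.
From mathcomp Require Import all_classical all_reals.
From mathcomp Require Import complex.
From mathcomp Require Import zify ring lra.

(** For z = a + b omega1 + c omega3 + d omega1 omega3 one computes
    6 |z|^2 = 2 M + 5 q - q sqrt 33 with integers M and q, so |z| determines M
    because sqrt 33 is irrational. Modulo 2, M is the norm form
    x^2 + x y + y^2 of F_4 evaluated at x = a + c + d and y = b + c, which is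
    anisotropic. Hence z |-> (x, y) mod 2 is a homomorphism onto a group of
    order 4 whose kernel is described by |z| alone, and unit vectors (M = 3)
    are not in the kernel: its cosets form a geometric coloring. *)

Import Order.TTheory GRing.Theory Num.Theory.

Local Open Scope ring_scope.

(** * Colorings in which distance alone decides whether two vertices share a color *)

Section ColoringByDistance.
Context {R : realType} {G : udgraph R} {C : finType}.
Variable col : vertices G -> C.
Hypothesis col_edge : forall x y, edge x y -> col x != col y.
Hypothesis col_dist : forall x y x' y',
  `|val x - val y| = `|val x' - val y'| -> (col x == col y) = (col x' == col y').

Let color_class (k : C) : {set vertices G} := [set y | col y == k].

Lemma independent_color_class k : independent (color_class k).
Proof.
apply/'forall_implyP => x; rewrite inE => /eqP xk.
apply/'forall_implyP => y; rewrite inE => /eqP yk.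
by apply/negP => /col_edge; rewrite xk yk eqxx.
Qed.

Let iclass k : indep_set G :=
  exist (fun S : {set vertices G} => independent S) _ (independent_color_class k).

Let class_coloring (Z : indep_set G) : R :=
  (Z \in [set iclass (col x) | x : vertices G])%:R.

Lemma colors_class_coloring :
  colors class_coloring = [set iclass (col x) | x : vertices G].
Proof.
apply/setP => Z; rewrite inE /class_coloring.
by case: (_ \in _); rewrite ?eqxx// eq_sym oner_eq0.
Qed.

Lemma mem_iclass k x : (x \in val (iclass k)) = (col x == k).
Proof. by rewrite inE. Qed.

Lemma class_coloring1 x : class_coloring (iclass (col x)) = 1.
Proof. by rewrite /class_coloring; case: imsetP => // -[]; exists x. Qed.

(** A class containing [S] contains [x], so only the class of [x] can contribute, and it does so
    exactly when [S] is monochromatic. The geometric condition thus reduces to isometries preserving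
    monochromaticity. *)
Lemma sum_class_coloring (S : {set vertices G}) x : x \in S ->
  \sum_(Z : indep_set G | S \subset val Z) class_coloring Z =
  [forall y in S, col y == col x]%:R.
Proof.
move=> xS; case: (boolP [forall y in S, _]) => [/'forall_implyP mono|nmono].
  rewrite (bigD1 (iclass (col x)))/=; last first.
    by apply/fintype.subsetP => y yS; rewrite inE mono.
  rewrite class_coloring1 big1 ?addr0// => Z /andP[SZ nZ].
  rewrite /class_coloring; case: imsetP => // -[y _ eZ]; move: nZ.
  have /fintype.subsetP/(_ x xS) := SZ.
  by rewrite eZ mem_iclass => /eqP ->; rewrite eqxx.
rewrite big1// => Z SZ; rewrite /class_coloring; case: imsetP => // -[y _ eZ].
case/negP: nmono; apply/'forall_implyP => z zS.
have /fintype.subsetP SZ' := SZ.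
have := SZ' x xS; have := SZ' z zS.
by rewrite eZ !mem_iclass => /eqP -> /eqP ->.
Qed.

Lemma geometric_class_coloring : geometric_fractional_coloring class_coloring.
Proof.
split; first split=> [Z|x]; first by rewrite /class_coloring ler0n.
  under eq_bigl do rewrite -finset.sub1set.
  rewrite (sum_class_coloring _ x) ?finset.set11//.
  suff -> : [forall y in [set x], col y == col x] by [].
  by apply/'forall_implyP => y /set1P ->.
move=> S _ [f <- fd].
have [->|[x xS]] := set_0Vmem S; first by rewrite imset0.
rewrite (sum_class_coloring _ x)// (sum_class_coloring _ (f x)) ?imset_f//.
(* Colors are compared with that of the base vertex [x]; the isometry preserves distances to it, so
   [col_dist] transfers each comparison. *)
congr (_ %:R); congr nat_of_bool; apply/'forall_implyP/'forall_implyP => mono.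
  by move=> _ /imsetP[y yS ->]; rewrite (col_dist _ _ _ _ (fd _ _ yS xS)) mono.
by move=> y yS; rewrite -(col_dist _ _ _ _ (fd _ _ yS xS)) mono// imset_f.
Qed.

Lemma integral_class_coloring : integral_coloring class_coloring.
Proof.
split=> [S|x].
  by rewrite /class_coloring; case: (_ \in _); [right|left].
exists (iclass (col x)); rewrite colors_class_coloring; split.
  by split; [exact: imset_f|rewrite inE].
by move=> Z [/imsetP[y _ ->]]; rewrite inE => /eqP ->.
Qed.

Lemma card_colors_class_coloring : (#|colors class_coloring| <= #|C|)%N.
Proof.
rewrite colors_class_coloring (leq_trans _ (leq_imset_card iclass C))//.
apply/subset_leq_card/fintype.subsetP => _ /imsetP[x _ ->].
exact: imset_f.
Qed.

Lemma chi_gf_le : chi_gf G <= #|C|%:R.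
Proof.
apply: (@le_trans _ _ #|colors class_coloring|%:R); last first.
  by rewrite ler_nat card_colors_class_coloring.
apply: ge_inf.
  by exists 0 => _ [g [[g0 _] _] <-]; apply: sumr_ge0 => Z _; exact: g0.
exists class_coloring; first exact: geometric_class_coloring.
(* The values are 0 or 1, so the total weight is the number of colors. *)
rewrite colors_class_coloring -sum1_card natr_sum [RHS]big_mkcond.
by apply: eq_bigr => Z _; rewrite /class_coloring; case: (_ \in _).
Qed.

Lemma geometric_coloring_of_distance :
  (exists g : indep_set G -> R,
     [/\ geometric_fractional_coloring g, integral_coloring g
       & (#|colors g| <= #|C|)%N]) /\
  chi_gf G <= #|C|%:R.
Proof.
split; last exact: chi_gf_le.
exists class_coloring; split; [exact: geometric_class_coloring|
  exact: integral_class_coloring|exact: card_colors_class_coloring].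
Qed.

End ColoringByDistance.

(** * Norms and parity in the Moser lattice *)

Definition moser_point (R : realType) (a b c d : int) : R[i] :=
  a%:~R + b%:~R * omega1 R + c%:~R * omega3 R + d%:~R * (omega1 R * omega3 R).

(** The rational part of 6 |z|^2 contains 5 (a d + b c); subtracting 5 q with q = a d - b c turns
    this into 10 b c, so the remainder is even, and M is its half. *)
Definition moser_M (a b c d : int) : int :=
  3 * (a ^+ 2 + a * b + b ^+ 2 + c ^+ 2 + c * d + d ^+ 2)
  + 5 * (a * c + b * c + b * d).

Definition moser_q (a b c d : int) : int := a * d - b * c.

Lemma moser_pointB (R : realType) (a b c d a' b' c' d' : int) :
  moser_point R a b c d - moser_point R a' b' c' d' =
  moser_point R (a - a') (b - b') (c - c') (d - d').
Proof. by rewrite /moser_point !intrB; ring. Qed.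

Lemma moser_pointE (R : realType) (a b c d : int) :
  moser_point R a b c d =
  ((a%:~R + b%:~R / 2 + c%:~R * (5 / 6)
    + d%:~R * (5 / 12 - Num.sqrt 3 * Num.sqrt 11 / 12))
   +i* (b%:~R * (Num.sqrt 3 / 2) + c%:~R * (Num.sqrt 11 / 6)
    + d%:~R * (5 * Num.sqrt 3 / 12 + Num.sqrt 11 / 12)))%C.
Proof.
have intC (n : int) : n%:~R = (n%:~R +i* 0)%C :> R[i].
  by rewrite -(rmorph_int (real_complex R)).
rewrite /moser_point /omega1 /omega3 !intC; simpc.
by apply/eqP; rewrite eq_complex /=; apply/andP; split; apply/eqP; field.
Qed.

Lemma moser_normsq (R : realType) (a b c d : int) :
  6 * (complex.Re (moser_point R a b c d) ^+ 2
       + complex.Im (moser_point R a b c d) ^+ 2) =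
  (2 * moser_M a b c d + 5 * moser_q a b c d)%:~R
  - (moser_q a b c d)%:~R * (Num.sqrt 3 * Num.sqrt 11).
Proof.
rewrite moser_pointE /= /moser_M /moser_q.
have : Num.sqrt 3 ^+ 2 = 3 :> R by rewrite sqr_sqrtr.
have : Num.sqrt 11 ^+ 2 = 11 :> R by rewrite sqr_sqrtr.
rewrite !(intrD, mulrNz, intrM) /=.
(* With the roots as variables known only through their squares, the claim is a purely algebraic
   identity. *)
move: (Num.sqrt _) (Num.sqrt _) (a%:~R) (b%:~R) (c%:~R) (d%:~R) => t u {}a {}b {}c {}d.
move=> u2 t2.
by field: u2 t2.
Qed.

Lemma eq_normc_sq (R : realType) (z w : R[i]) : `|z| = `|w| ->
  complex.Re z ^+ 2 + complex.Im z ^+ 2 = complex.Re w ^+ 2 + complex.Im w ^+ 2.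
Proof.
move=> zw; apply: (@complexI R).
by rewrite !add_Re2_Im2 zw.
Qed.

(** For nonzero [v] the exponent of 3 is even in u^2 but odd in 33 v^2. *)
Lemma sqr_eq_33sqr (u v : int) : u ^+ 2 = 33 * v ^+ 2 -> v = 0.
Proof.
move=> /(congr1 absz); rewrite abszM !abszX => uv.
apply/eqP; rewrite -absz_eq0 -leqn0 leqNgt; apply/negP => v0.
have := congr1 (odd \o logn 3) uv.
by rewrite /= lognM ?expn_gt0 ?v0// !lognX oddD !oddM.
Qed.

Lemma moser_M_of_norm (R : realType) (a b c d a' b' c' d' : int) :
  `|moser_point R a b c d| = `|moser_point R a' b' c' d'| ->
  moser_M a b c d = moser_M a' b' c' d'.
Proof.
move/eq_normc_sq/(congr1 (fun x => 6 * x)); rewrite !moser_normsq.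
move: (moser_M a b c d) (moser_M a' b' c' d') => M M'.
move: (moser_q a b c d) (moser_q a' b' c' d') => q q' e.
have e' : (2 * (M - M') + 5 * (q - q'))%:~R =
    (q - q')%:~R * (Num.sqrt 3 * Num.sqrt 11) :> R.
  by move: e; rewrite !(intrD, mulrNz, intrM); lra.
(* Squaring [e'] gives an integer square equal to 33 (q - q')^2. *)
have q0 : q - q' = 0.
  apply: (@sqr_eq_33sqr (2 * (M - M') + 5 * (q - q'))).
  apply/eqP; rewrite -(eqr_int R) intrM !rmorphXn /= e' !exprMn !sqr_sqrtr//.
  by apply/eqP; ring.
move: e'; rewrite q0 mul0r => /eqP; rewrite intr_eq0 => /eqP.
lia.
Qed.

Lemma moser_M_even (a b c d : int) :
  (2 %| moser_M a b c d)%Z = (2 %| a + c + d)%Z && (2 %| b + c)%Z.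
Proof.
(* The parity of M depends only on the parities of the coordinates, which leaves sixteen cases. *)
have split2 (n : int) : exists k (e : bool), n = k * 2 + e%:Z.
  by exists (n %/ 2)%Z, (n %% 2 == 1)%Z; lia.
have [a' [e1 ->]] := split2 a; have [b' [e2 ->]] := split2 b.
have [c' [e3 ->]] := split2 c; have [d' [e4 ->]] := split2 d.
rewrite /moser_M; case: e1; case: e2; case: e3; case: e4 => /=; lia.
Qed.

Theorem mainTheorem2 (R : realType) (G : udgraph R)
    (hV : forall x : R[i], x \in vertices G -> moser_lattice x) :
  (exists g : indep_set G -> R,
     [/\ geometric_fractional_coloring g, integral_coloring g
       & (#|colors g| <= 4)%N]) /\
  chi_gf G <= 4.
Proof.
have coords (x : vertices G) : exists t : int * int * int * int,
    val x = moser_point R t.1.1.1 t.1.1.2 t.1.2 t.2.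
  have [a [b [c [d xE]]]] := hV (val x) (valP x).
  by exists (a, b, c, d).
have [t tE] := boolp.choice coords.
(* The color is the coset of the kernel, recorded by the evenness of both components of the
   homomorphism. *)
pose col (x : vertices G) : bool * bool :=
  let: (a, b, c, d) := t x in ((2 %| a + c + d)%Z, (2 %| b + c)%Z).
pose M x y := moser_M ((t x).1.1.1 - (t y).1.1.1) ((t x).1.1.2 - (t y).1.1.2)
  ((t x).1.2 - (t y).1.2) ((t x).2 - (t y).2).
have colE x y : (col x == col y) = (2 %| M x y)%Z.
  rewrite /M moser_M_even /col; case: (t x) (t y) => [[[a b] c] d] [[[a' b'] c'] d'] /=.
  by rewrite xpair_eqE; lia.
have -> : 4 = #|{: bool * bool}|%:R :> R by rewrite card_prod card_bool.
have -> : 4%N = #|{: bool * bool}| by rewrite card_prod card_bool.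
apply: (@geometric_coloring_of_distance R G _ col) => [x y /edge_dist1|x y x' y'].
  rewrite !tE moser_pointB colE /M => n1.
  (* The point 1 serves as reference: every difference of norm 1 has the same M as it, namely the
     odd number 3. *)
  have unit : `|moser_point R 1 0 0 0| = 1.
    by rewrite /moser_point !mul0r !addr0 normr1.
  by move: n1; rewrite -unit => /moser_M_of_norm ->.
by rewrite !tE !moser_pointB !colE => /moser_M_of_norm; rewrite /M => ->.
Qed.
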